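(* $\diamondsuit$ implies the existence of a Suslin algebra on which the games $\mathcal{G}_1$, $\mathcal{G}_2$, $\mathcal{G}_3$ and $\mathcal{G}_4$ are (all) undetermined.
   Context: $\diamondsuit$ is the statement: there is a sequence $\langle S_\alpha:\alpha<\omega_1\rangle$ with $S_\alpha\subseteq\alpha$ such that for every $X\subseteq\omega_1$ the set $\{\alpha<\omega_1:X\cap\alpha=S_\alpha\}$ is stationary in $\omega_1$. A Suslin algebra is an atomless complete Boolean algebra which satisfies the countable chain condition and is $\omega$-distributive (forcing with it adds no new $\omega$-sequences of ground-model elements). For a complete Boolean algebra $\mathbb{B}$ let $\mathbb{B}^+=\mathbb{B}\setminus\{0\}$ and $(0,p)_{\mathbb{B}}=\{b\in\mathbb{B}:0<b<p\}$. The games $\mathcal{G}_k$, $k\in\{1,2,3,4\}$, are played by two players, White and Black, on $\mathbb{B}$ in $\omega$-many moves. At the beginning White chooses $p\in\mathbb{B}^+$. In the $n$-th move ($n\in\omega$) White chooses $p_n\in(0,p)_{\mathbb{B}}$ and Black responds by choosing $i_n\in\{0,1\}$. Put $p_n^0=p_n$ and $p_n^1=p\setminus p_n$. White wins the play $\langle p,p_0,i_0,p_1,i_1,\dots\rangle$ in the game $\mathcal{G}_1$ iff $\bigwedge_{n\in\omega}p_n^{i_n}=0$; $\mathcal{G}_2$ iff $\bigvee_{k\in\omega}\bigwedge_{n\ge k}p_n^{i_n}=0$; $\mathcal{G}_3$ iff $\bigvee_{A\in[\omega]^{\omega}}\bigwedge_{n\in A}p_n^{i_n}=0$, where $[\omega]^\omega$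 is the set of infinite subsets of $\omega$; $\mathcal{G}_4$ iff $\bigwedge_{k\in\omega}\bigvee_{n\ge k}p_n^{i_n}=0$. Otherwise Black wins. A winning strategy for a player is a function which, on the basis of the previous moves of both players, provides moves (obeying the rules) for that player such that the player always wins. A game is undetermined on $\mathbb{B}$ if neither player has a winning strategy in it. *)

(* Defs.v *)
From mathcomp Require Import all_boot all_order.
From mathcomp Require Import boolp classical_sets cardinality wochoice.

Set Implicit Arguments.
Unset Strict Implicit.
Unset Printing Implicit Defensive.

Import Order.Theory.

Local Open Scope classical_set_scope.

(* A well-order is a copy of omega_1 iff it is uncountable and all its proper
   initial segments are countable. *)
Definition is_omega1 (d : Order.disp_t) (W : orderType d) : Prop :=
  [/\ well_founded (fun x y : W => (x < y)%O),
      ~ countable [set: W]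
    & forall a : W, countable [set x : W | (x < a)%O]].

Section Diamond.
Variables (d : Order.disp_t) (W : orderType d).

(* Closed and unbounded; the condition [exists b, b < a] together with the
   cofinality condition says that [a] is a limit point of [C]. *)
Definition club (C : set W) : Prop :=
  (forall a : W, exists2 b, C b & (a < b)%O) /\
  (forall a : W, (exists b, (b < a)%O) ->
     (forall b, (b < a)%O -> exists2 c, C c & (b < c < a)%O) -> C a).

Definition stationary (S : set W) : Prop :=
  forall C : set W, club C -> S `&` C !=set0.

Definition diamond : Prop :=
  exists S : W -> set W,
    (forall a, S a `<=` [set x | (x < a)%O]) /\
    (forall X : set W,
       stationary [set a | X `&` [set x | (x < a)%O] = S a]).

End Diamond.

Section BooleanAlgebra.
Variables (d : Order.disp_t) (B : ctbDistrLatticeType d).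

Definition complete : Prop := forall A : set B, supremums A !=set0.

(* Infinite joins and meets; they have their intended meaning when [B] is
   complete. *)
Definition bjoin (A : set B) : B := supremum \bot%O A.
Definition bmeet (A : set B) : B := infimum \top%O A.

Definition atomless : Prop :=
  forall b : B, (\bot < b)%O -> exists c : B, (\bot < c < b)%O.

Definition antichain (A : set B) : Prop :=
  (forall a, A a -> (\bot < a)%O) /\
  (forall a b, A a -> A b -> a <> b -> Order.meet a b = \bot%O).

Definition ccc : Prop := forall A : set B, antichain A -> countable A.

(* The (omega, kappa)-distributive law for all kappa. See
   [omega_distributiveP] below for the formulation in terms of forcing. *)
Definition omega_distributive : Prop :=
  forall (I : Type) (u : nat -> I -> B),
    bmeet (range (fun n => bjoin (range (u n)))) =
    bjoin (range (fun f : nat -> I => bmeet (range (fun n => u n (f n))))).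

(* [u n x] is the Boolean value of "t(n) = x", for a name t of a function from
   omega to X. *)
Definition sequence_name (X : Type) (u : nat -> X -> B) : Prop :=
  forall n, (forall x y, x <> y -> Order.meet (u n x) (u n y) = \bot%O) /\
            bjoin (range (u n)) = \top%O.

(* For every such t, the Boolean value of "t is in the ground model" is 1. *)
Definition no_new_omega_sequences : Prop :=
  forall (X : Type) (u : nat -> X -> B), sequence_name u ->
    bjoin (range (fun g : nat -> X => bmeet (range (fun n => u n (g n))))) =
    \top%O.

Definition suslin_algebra : Prop :=
  (\bot%O : B) <> \top%O /\
  [/\ complete, atomless, ccc & omega_distributive].

(* {0,1} is represented by bool: [side p b false] is b, [side p b true] is
   p \ b. *)
Definition side (p b : B) (i : bool) : B := if i then (p `\` b)%O else b.

(* [G p q i] means that White wins the play p, q 0, i 0, q 1, i 1, ... *)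
Definition game := B -> (nat -> B) -> (nat -> bool) -> Prop.

Definition G1 : game := fun p q i =>
  bmeet (range (fun n => side p (q n) (i n))) = \bot%O.

Definition G2 : game := fun p q i =>
  bjoin (range (fun k : nat =>
    bmeet [set side p (q n) (i n) | n in [set n | (k <= n)%N]])) = \bot%O.

Definition G3 : game := fun p q i =>
  bjoin [set bmeet [set side p (q n) (i n) | n in A]
        | A in [set A : set nat | infinite_set A]] = \bot%O.

Definition G4 : game := fun p q i =>
  bmeet (range (fun k : nat =>
    bjoin [set side p (q n) (i n) | n in [set n | (k <= n)%N]])) = \bot%O.

(* The moves (q k, i k), k < n, preceding the n-th one. *)
Definition history (q : nat -> B) (i : nat -> bool) (n : nat) :
  seq (B * bool) := mkseq (fun k => (q k, i k)) n.

Definition legal (p b : B) : Prop := (\bot < b < p)%O.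

(* A strategy for White is a first move p and a function of the history. As
   every finite history in which White follows the strategy extends to a play
   of length omega, it suffices to require legality along such plays. *)
Definition white_wins (G : game) (p : B) (sigma : seq (B * bool) -> B) : Prop :=
  (\bot < p)%O /\
  forall (q : nat -> B) (i : nat -> bool),
    (forall n, q n = sigma (history q i n)) ->
    (forall n, legal p (q n)) /\ G p q i.

(* Black's strategy depends on p, the history and White's current move. *)
Definition black_wins (G : game) (tau : B -> seq (B * bool) -> B -> bool) :
  Prop :=
  forall (p : B) (q : nat -> B) (i : nat -> bool),
    (\bot < p)%O -> (forall n, legal p (q n)) ->
    (forall n, i n = tau p (history q i n) (q n)) -> ~ G p q i.

Definition undetermined (G : game) : Prop :=
  ~ (exists p sigma, white_wins G p sigma) /\
  ~ (exists tau, black_wins G tau).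

Lemma bjoin_ub (A : set B) x : complete -> A x -> (x <= bjoin A)%O.
Proof.
move=> cB Ax; rewrite /bjoin /supremum; case: ifPn => [/eqP A0|_].
  by rewrite A0 in Ax.
case: xgetP => [s _ [us _]|H]; first exact: us.
by have [s /H] := cB A.
Qed.

Lemma bjoin_le (A : set B) y :
  complete -> (forall x, A x -> (x <= y)%O) -> (bjoin A <= y)%O.
Proof.
move=> cB Ay; rewrite /bjoin /supremum; case: ifPn => [_|_]; first exact: le0x.
case: xgetP => [s _ [_ sl]|H]; first exact: sl.
by have [s /H] := cB A.
Qed.

Lemma bmeet_exists (A : set B) : complete -> infimums A !=set0.
Proof.
move=> cB; have [s [us ls]] := cB (lbound A); exists s; split=> //.
by move=> x Ax; apply: ls => y; exact.
Qed.

Lemma bmeet_lb (A : set B) x : complete -> A x -> (bmeet A <= x)%O.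
Proof.
move=> cB Ax; rewrite /bmeet /infimum; case: ifPn => [/eqP A0|_].
  by rewrite A0 in Ax.
case: xgetP => [s _ [us _]|H]; first exact: us.
by have [s /H] := bmeet_exists A cB.
Qed.

Lemma bmeet_ge (A : set B) y :
  complete -> (forall x, A x -> (y <= x)%O) -> (y <= bmeet A)%O.
Proof.
move=> cB Ay; rewrite /bmeet /infimum; case: ifPn => [_|_]; first exact: lex1.
case: xgetP => [s _ [_ sl]|H]; first exact: sl.
by have [s /H] := bmeet_exists A cB.
Qed.

Lemma le_split (a x s : B) :
  (Order.meet x a <= s)%O -> (~` a <= s)%O -> (x <= s)%O.
Proof.
move=> xas nas; rewrite -(meetx1 x) -(joinxC a) meetUr leUx xas /=.
by apply: le_trans nas; exact: leIr.
Qed.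

Lemma omega_distributiveP :
  complete -> (omega_distributive <-> no_new_omega_sequences).
Proof.
move=> cB; split=> [dB X u nu|nB I u].
  rewrite -dB; apply/le_anti; rewrite lex1 /=.
  by apply: bmeet_ge => // _ [n _ <-]; rewrite (nu n).2.
set R := bjoin _ in |- *; set a := bmeet _.
apply/le_anti/andP; split; last first.
  apply: bjoin_le => // _ [f _ <-]; apply: bmeet_ge => // _ [n _ <-].
  apply: (@le_trans _ _ (u n (f n))); first by apply: bmeet_lb => //; exists n.
  by apply: bjoin_ub => //; exists (f n).
have [r wr] := well_ordering_principle {classic I}.
pose lt (y x : I) : Prop := r y x /\ y <> x.
have least (P : I -> Prop) : (exists x, P x) ->
    exists x, P x /\ forall y, lt y x -> ~ P y.
  case=> x0 Px0.
  have [|x [[/asboolP Px minx] _]] := wr (fun x : I => `[< P x >]).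
    by exists x0; apply/asboolP.
  exists x; split=> // y [ryx yx] Py; apply: yx.
  have [|z [_ uz]] := wr (fun z : I => `[< z = x \/ z = y >]).
    by exists x; apply/asboolP; left.
  have rxx : r x x by apply: minx; apply/asboolP.
  have rxy : r x y by apply: minx; apply/asboolP.
  have ryy : r y y.
    have [|w [[/asboolP wy minw] _]] := wr (fun w : I => `[< w = y >]).
      by exists y; apply/asboolP.
    by rewrite wy in minw; apply: minw; apply/asboolP.
  have <- : z = y.
    by apply: uz; split=> [|w /asboolP[->|->] //]; apply/asboolP; right.
  by apply: uz; split=> [|w /asboolP[->|->] //]; apply/asboolP; left.
have tri x y : x <> y -> lt x y \/ lt y x.
  move=> xy.
  have [|z [[/asboolP zz minz] _]] := wr (fun z : I => `[< z = x \/ z = y >]).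
    by exists x; apply/asboolP; left.
  case: zz => ez; rewrite ez in minz.
    by left; split=> //; apply: minz; apply/asboolP; right.
  by right; split; [apply: minz; apply/asboolP; left|move=> /esym].
pose J n x := bjoin [set u n y | y in [set y | lt y x]].
pose v n (o : option I) : B :=
  if o is Some x then Order.meet a (u n x `\` J n x)%O else (~` a)%O.
have vlt n x y : lt x y -> Order.meet (v n (Some x)) (v n (Some y)) = \bot%O.
  move=> xy; apply/le_anti; rewrite le0x andbT /=.
  have xJ : (u n x <= J n y)%O by apply: bjoin_ub => //; exists x.
  have le1 : (Order.meet a (u n x `\` J n x) <= J n y)%O.
    by apply: le_trans xJ; apply: (le_trans (leIr _ _)); exact: leBx.
  have le2 : (Order.meet a (u n y `\` J n y) <= u n y `\` J n y)%O.
    exact: leIr.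
  by apply: (le_trans (leI2 le1 le2)); rewrite diffKI.
have vN n x : Order.meet (v n (Some x)) (v n None) = \bot%O.
  apply/le_anti; rewrite le0x andbT /=.
  by apply: (le_trans (leI2 (leIl _ _) (lexx _))); rewrite meetxC.
have nv : sequence_name v.
  move=> n; split.
    move=> [x|] [y|] xy.
    - have nxy : x <> y by move=> e; apply: xy; rewrite e.
      have [|yx] := tri x y nxy; first exact: vlt.
      by rewrite meetC; exact: vlt.
    - exact: vN.
    - by rewrite meetC; exact: vN.
    - by [].
  set s := bjoin _; apply/le_anti; rewrite lex1 /=.
  have nas : (~` a <= s)%O by apply: bjoin_ub => //; exists None.
  have ux x : (u n x <= s)%O.
    apply/negP => /negP nx.
    have [|{nx} x [/negP + minx]] := least (fun x => ~ (u n x <= s)%O).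
      by exists x; exact/negP.
    apply/negP; rewrite negbK.
    have Js : (J n x <= s)%O.
      by apply: bjoin_le => // _ [y yx <-]; apply: contrapT; exact: minx.
    apply: (le_split _ nas); rewrite meetC -(joinIB (J n x) (u n x)) meetUr leUx.
    apply/andP; split.
      by apply: (le_trans (leIr _ _)); apply: (le_trans (leIr _ _)).
    by apply: bjoin_ub => //; exists (Some x).
  apply: (le_split _ nas); apply: (le_trans (leIr _ _)).
  apply: (@le_trans _ _ (bjoin (range (u n)))).
    by apply: bmeet_lb => //; exists n.
  by apply: bjoin_le => // _ [x _ <-].
have RT : (\top <= Order.join R (~` a))%O.
  rewrite -(nB _ _ nv); apply: bjoin_le => // _ [g _ <-].
  have [[n gn]|ng] := pselect (exists n, g n = None).
    apply: (@le_trans _ _ (v n (g n))).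
      by apply: bmeet_lb => //; exists n.
    by rewrite gn /=; exact: leUr.
  have /choice[f gf] : forall n, exists x, g n = Some x.
    move=> n; case E : (g n) => [x|]; first by exists x.
    by exfalso; apply: ng; exists n.
  apply: (@le_trans _ _ R); last exact: leUl.
  apply: (@le_trans _ _ (bmeet (range (fun n => u n (f n))))).
    apply: bmeet_ge => // _ [n _ <-].
    apply: (@le_trans _ _ (v n (g n))).
      by apply: bmeet_lb => //; exists n.
    by rewrite gf /=; apply: (le_trans (leIr _ _)); exact: leBx.
  by apply: bjoin_ub => //; exists f.
rewrite -(meetx1 a); apply: (le_trans (leI2 (lexx a) RT)).
by rewrite meetUr meetxC joinx0; exact: leIr.
Qed.

End BooleanAlgebra.

(* Main.v *)
Require Import Defs.
From HB Require Import structures.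
From mathcomp Require Import all_boot all_order.
From mathcomp Require Import boolp classical_sets cardinality.

(** The algebra is the algebra of regular open sets of a Suslin tree of height
    [omega_1] with countable levels, built so that the tree also defeats every
    strategy of Black.

    The conditions under which White wins get weaker from [G4] to [G3], [G2] and
    [G1], so only two things have to be excluded: a winning strategy of White in
    [G1] and one of Black in [G4] ([undetermined_between]).

    White cannot win [G1] on any algebra of a Suslin tree ([white_loses_G1]).
    Against a strategy of White only countably many positions can arise, and
    some level of the tree decides all the moves made in them; Black picks a
    node of that level below [p] and keeps it in every side selected.

    Black's strategies have to be killed one by one, by diamond
    ([black_loses_G4]). The nodes of every level are indexed by natural numbers,
    and White only ever plays [evens b], the set of nodes whose ancestor on
    level [b] has an even index. Such a move is determined by [b], so a strategy
    of Black restricted to these moves is a function from finite sequences of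
    levels to bool, an object that diamond can guess. At a limit level [a] take
    a sequence of levels cofinal in [a] and let White play along it against the
    guess. This fixes Black's answers in advance. Then each branch that is
    extended to level [a] is chosen so that from some point on its parity is the
    one that Black has rejected ([branch_exists]). All nodes of level [a], and
    so a dense set of nodes, lie in only finitely many of the selected sides:
    the limit superior is [0].

    The same guesses seal dense sets in the usual way: when the guess at [a] is
    a dense subset of the tree below [a], all branches extended to level [a] are
    made to meet it. So every dense open set contains a whole level
    ([tree_seal]), from which the countable chain condition and
    [omega]-distributivity follow ([tree_ccc], [tree_omega_distributive]). *)

Set Implicit Arguments.
Unset Strict Implicit.
Unset Printing Implicit Defensive.

Import Order.Theory.

Local Open Scope classical_set_scope.

(** * The algebra of regular open subsets of a preorder *)

Record preorder := Preorder {
  pcar :> Type;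
  ple : pcar -> pcar -> Prop;
  ple_refl : forall x, ple x x;
  ple_trans : forall y x z, ple x y -> ple y z -> ple x z }.
Arguments ple {p}.

Section RegularOpen.
Variable P : preorder.
Implicit Types (x y z : P) (U V : set P).

(** The interior of the closure of [U] in the topology whose open sets are the
    downward closed ones; its fixed points are the regular open sets. *)
Definition cl U : set P :=
  [set x | forall y, ple y x -> exists2 z, ple z y & U z].

Definition down_closed U := forall x y, ple y x -> U x -> U y.

Lemma cl_down U : down_closed (cl U).
Proof. by move=> x y yx Ux z zy; apply: Ux; apply: ple_trans yx. Qed.

Lemma cl_idem U : cl (cl U) = cl U.
Proof.
apply/seteqP; split=> x Ux y yx; last first.
  by exists y; [exact: ple_refl|exact: cl_down Ux].
have [z zy Uz] := Ux y yx.
have [t tz Ut] := Uz z (ple_refl z).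
by exists t => //; exact: ple_trans zy.
Qed.

Lemma sub_cl U : down_closed U -> U `<=` cl U.
Proof. by move=> dU x Ux y yx; exists y; [exact: ple_refl|exact: dU Ux]. Qed.

Record ro := Ro { ro_set :> set P; ro_closed : cl ro_set = ro_set }.

Lemma ro_inj (a b : ro) : ro_set a = ro_set b -> a = b.
Proof.
case: a b => [U cU] [V cV] /= UV; case: _ / UV in cV *.
by rewrite (Prop_irrelevance cU cV).
Qed.

Lemma ro_down (a : ro) : down_closed a.
Proof. by rewrite -ro_closed; exact: cl_down. Qed.

Lemma ro_dense (a : ro) x :
  (forall y, ple y x -> exists2 z, ple z y & ro_set a z) -> ro_set a x.
Proof. by move=> H; rewrite -ro_closed. Qed.

Definition ro_cl U : ro := Ro (cl_idem U).

Lemma ro_meet_closed (a b : ro) : cl (a `&` b) = a `&` b.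
Proof.
apply/seteqP; split=> [x ab|x [ax bx]].
  by split; apply: ro_dense => y /ab[z zy []]; exists z.
by apply: sub_cl => // {ax bx} x' y yx [ax bx]; split; apply: ro_down yx _.
Qed.

Definition ro_meet a b := Ro (ro_meet_closed a b).
Definition ro_join (a b : ro) := ro_cl (a `|` b).
Definition ro_compl (a : ro) :=
  ro_cl [set x | forall y, ple y x -> ~ ro_set a y].
Definition ro_le (a b : ro) : bool := `[< ro_set a `<=` ro_set b >].

HB.instance Definition _ := gen_eqMixin ro.
HB.instance Definition _ := gen_choiceMixin ro.

Fact ro_le_refl : reflexive ro_le.
Proof. by move=> a; apply/asboolP. Qed.
Fact ro_le_anti : antisymmetric ro_le.
Proof.
by move=> a b /andP[/asboolP ab /asboolP ba]; apply: ro_inj; apply/seteqP.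
Qed.
Fact ro_le_trans : transitive ro_le.
Proof.
move=> b a c /asboolP ab /asboolP bc; apply/asboolP.
exact: subset_trans bc.
Qed.

Fact ro_display : Order.disp_t. Proof. exact: (Order.Disp tt tt). Qed.

HB.instance Definition _ :=
  Order.Le_isPOrder.Build ro_display ro ro_le_refl ro_le_anti ro_le_trans.

Lemma ro_leP (a b : ro) : reflect (ro_set a `<=` ro_set b) (a <= b)%O.
Proof. exact: asboolP. Qed.

Fact ro_meetP (a b c : ro) : (a <= ro_meet b c)%O = (a <= b)%O && (a <= c)%O.
Proof.
apply/ro_leP/andP => [H|[/ro_leP ab /ro_leP ac] x ax].
  by split; apply/ro_leP => x /H[].
by split; [exact: ab|exact: ac].
Qed.

Fact ro_joinP (a b c : ro) : (ro_join a b <= c)%O = (a <= c)%O && (b <= c)%O.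
Proof.
apply/ro_leP/andP => [H|[/ro_leP ac /ro_leP bc] x abx]; last first.
  by apply: ro_dense => y /abx[z zy [/ac|/bc]]; exists z.
split; apply/ro_leP => x ax; apply: H.
  by move=> y yx; exists y; [exact: ple_refl|left; exact: ro_down ax].
by move=> y yx; exists y; [exact: ple_refl|right; exact: ro_down ax].
Qed.

HB.instance Definition _ :=
  Order.POrder_MeetJoin_isLattice.Build ro_display ro ro_meetP ro_joinP.

Lemma ro_meetE (a b : ro) :
  ro_set (Order.meet a b) = ro_set a `&` ro_set b.
Proof. by []. Qed.

Lemma ro_joinE (a b : ro) :
  ro_set (Order.join a b) = cl (ro_set a `|` ro_set b).
Proof. by []. Qed.

(** Meets are plain intersections and only joins are closed up, so
    distributivity needs no more than that [c] is downward closed. *)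
Fact ro_meetUl : @left_distributive ro ro Order.meet Order.join.
Proof.
move=> a b c; apply: le_anti; apply/andP; split; last first.
  by rewrite leUx !leI2 // ?leUl ?leUr.
apply/ro_leP; rewrite ro_meetE !ro_joinE => x [abx cx] y yx.
have [z zy abz] := abx y yx.
have cz : ro_set c z by apply: ro_down cx; exact: ple_trans yx.
by exists z => //; case: abz; [left|right].
Qed.

HB.instance Definition _ :=
  Order.Lattice_Meet_isDistrLattice.Build ro_display ro ro_meetUl.

Fact ro_setT_closed : cl [set: P] = [set: P].
Proof. by apply/seteqP; split=> // x _; exact: sub_cl. Qed.
Fact ro_set0_closed : cl set0 = (set0 : set P).
Proof. by apply/seteqP; split=> // x /(_ x (ple_refl x)) []. Qed.
Definition ro_top := Ro ro_setT_closed.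
Definition ro_bot := Ro ro_set0_closed.
Fact ro_le0x (a : ro) : (ro_bot <= a)%O. Proof. by apply/ro_leP. Qed.
Fact ro_lex1 (a : ro) : (a <= ro_top)%O. Proof. by apply/ro_leP. Qed.

HB.instance Definition _ := Order.hasBottom.Build ro_display ro ro_le0x.
HB.instance Definition _ := Order.hasTop.Build ro_display ro ro_lex1.

(** The set in the definition of [ro_compl] is already closed. *)
Lemma ro_complP (a : ro) x :
  ro_set (ro_compl a) x <-> (forall y, ple y x -> ~ ro_set a y).
Proof.
split=> [H y yx ay|H]; last first.
  apply: sub_cl => // {}x y yx {}H z zy; apply: H; exact: ple_trans yx.
have [z zy /(_ z (ple_refl z))] := H y yx; apply; exact: ro_down ay.
Qed.

Fact ro_joinxC (a : ro) : Order.join a (ro_compl a) = \top%O.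
Proof.
apply: le_anti; rewrite lex1; apply/ro_leP; rewrite ro_joinE => x _ y _.
have [[z zy az]|H] := pselect (exists2 z, ple z y & ro_set a z).
  by exists z => //; left.
exists y; first exact: ple_refl.
by right; apply/ro_complP => z zy az; apply: H; exists z.
Qed.

Fact ro_meetxC (a : ro) : Order.meet a (ro_compl a) = \bot%O.
Proof.
apply: le_anti; rewrite le0x andbT; apply/ro_leP => x [ax].
by move=> /ro_complP /(_ x (ple_refl x)).
Qed.

HB.instance Definition _ :=
  Order.TBDistrLattice_hasComplement.Build ro_display ro ro_joinxC ro_meetxC.

Lemma ro_complete : complete ro.
Proof.
move=> A; exists (ro_cl (\bigcup_(a in A) ro_set a)); split.
  move=> a Aa; apply/ro_leP; apply: subset_trans (sub_cl _).
    by move=> x ax; exists a.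
  by move=> x y yx [b Ab bx]; exists b => //; exact: ro_down bx.
move=> b ub; apply/ro_leP => x Ux; apply: ro_dense => y /Ux[z zy [a Aa az]].
by exists z => //; have /ro_leP := ub _ Aa; exact.
Qed.

Lemma ro_bjoinP (A : set ro) x : ro_set (bjoin A) x <->
  (forall y, ple y x -> exists2 z, ple z y & exists2 a : ro, A a & ro_set a z).
Proof.
split=> [Ax y yx|H]; last first.
  apply: ro_dense => y /H[z zy [a Aa az]]; exists z => //.
  by have /ro_leP := bjoin_ub ro_complete Aa; exact.
have /ro_leP /(_ x Ax y yx) [z zy [a Aa az]] :
    (bjoin A <= ro_cl (\bigcup_(a in A) ro_set a))%O.
  apply: bjoin_le; first exact: ro_complete.
  move=> a Aa; apply/ro_leP; apply: subset_trans (sub_cl _).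
    by move=> t ax; exists a.
  by move=> t u yt [b Ab bx]; exists b => //; exact: ro_down bx.
by exists z => //; exists a.
Qed.

Lemma ro_bmeetP (A : set ro) x :
  ro_set (bmeet A) x <-> (forall a, A a -> ro_set a x).
Proof.
split=> [Ax a Aa|H].
  by have /ro_leP := bmeet_lb ro_complete Aa; exact.
have /ro_leP : (ro_cl [set y | ple y x] <= bmeet A)%O.
  apply: bmeet_ge => [|a Aa]; first exact: ro_complete.
  apply/ro_leP => y yx; apply: ro_dense => z zy.
  have [t tz tx] := yx z zy.
  by exists t => //; apply: ro_down tx (H _ Aa).
by apply; move=> y yx; exists y => //; exact: ple_refl.
Qed.

Lemma ro_eq0P (a : ro) : a = \bot%O <-> (forall x, ~ ro_set a x).
Proof.
split=> [-> x []|H].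
by apply: ro_inj; apply/seteqP; split=> // x /H.
Qed.

Lemma ro_gt0P (a : ro) : (\bot < a)%O <-> (exists x, ro_set a x).
Proof.
rewrite lt0x; split=> [/eqP a0|[x ax]]; last first.
  by apply/eqP => a0; rewrite a0 in ax.
by apply: contrapT => H; apply: a0; apply/ro_eq0P => x ax; apply: H; exists x.
Qed.

Lemma ro_diffP (a b : ro) x :
  ro_set (a `\` b)%O x <-> (ro_set a x /\ forall y, ple y x -> ~ ro_set b y).
Proof.
rewrite diffE; split=> [[ax /ro_complP]|[ax bx]] //.
by split=> //; apply/ro_complP.
Qed.

End RegularOpen.

(** * Countable sets and recursion *)

Lemma countable_inj (T : Type) (A : set T) : countable A ->
  exists j : T -> nat, forall x y, A x -> A y -> j x = j y -> x = y.
Proof.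
move=> /countable_injP[j jinj]; exists j => x y Ax Ay.
by apply: jinj; rewrite inE.
Qed.

Lemma inj_countable (T : Type) (A : set T) (U : countType) (j : T -> U) :
  (forall x y, A x -> A y -> j x = j y -> x = y) -> countable A.
Proof.
move=> jinj; apply/countable_injP; exists (pickle \o j) => x y.
rewrite !inE => Ax Ay /= /(pcan_inj pickleK); exact: jinj.
Qed.

Lemma countable_setU (T : Type) (A B : set T) :
  countable A -> countable B -> countable (A `|` B).
Proof.
move=> cA cB; have -> : A `|` B = \bigcup_b (if b then A else B).
  apply/seteqP; split=> [x [Ax|Bx]|x [[] _]].
  - by exists true.
  - by exists false.
  - by left.
  - by right.
by apply: bigcup_countable => [|[] _] //; exact: countableP.
Qed.

Lemma countable_image (T U : Type) (f : T -> U) (A : set T) :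
  countable A -> countable (f @` A).
Proof. exact/card_le_trans/card_image_le. Qed.

Lemma countable_range (T : countType) (U : Type) (f : T -> U) :
  countable (range f).
Proof. exact/countable_image/countableP. Qed.

(** Recursion in which the value at [a] only has to satisfy a requirement that
    refers to the values below [a]. The existence hypothesis may use that the
    earlier values meet their own requirements, which is why the recursion
    chooses by excluded middle and correctness is proved afterwards by
    induction. *)
Lemma wf_choice (W V : Type) (R : W -> W -> Prop)
    (Phi : W -> (W -> V) -> V -> Prop) (v0 : V) :
  well_founded R ->
  (forall a f g v, (forall b, R b a -> f b = g b) -> Phi a f v -> Phi a g v) ->
  (forall a f, (forall b, R b a -> Phi b f (f b)) -> exists v, Phi a f v) ->
  exists f, forall a, Phi a f (f a).
Proof.
move=> wfR loc ex.
pose pick (A : set V) :=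
  if pselect (exists v, A v) is left h then sval (cid h) else v0.
pose body a (rec : forall b, R b a -> V) : V :=
  pick [set v | Phi a (fun b => if pselect (R b a) is left h then rec b h
                                   else v0) v].
pose f := Fix wfR (fun _ => V) body.
have fE a : f a = pick [set v | Phi a f v].
  rewrite /f Fix_eq; last first.
    move=> x r1 r2 r12; congr body.
    by apply: functional_extensionality_dep => b; apply: funext => h.
  rewrite /body; congr (pick _); apply/seteqP; split=> v /=; apply: loc => b;
    by case: pselect.
exists f => a; elim/(well_founded_ind wfR): a => a IH.
by rewrite fE /pick; case: pselect => [h|[]];
  [exact: (svalP (cid h))|exact: ex].
Qed.

(** * The first uncountable ordinal and diamond *)

Section Omega1.
Variables (d : Order.disp_t) (W : orderType d).
Hypothesis hW : is_omega1 W.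
Implicit Types a b c : W.

Lemma W_wf : well_founded (fun x y : W => (x < y)%O).
Proof. by case: hW. Qed.

Lemma W_seg a : countable [set x : W | (x < a)%O].
Proof. by case: hW. Qed.

Lemma W_least (A : set W) : A !=set0 ->
  exists2 c, A c & forall b, (b < c)%O -> ~ A b.
Proof.
case=> c0; elim/(well_founded_ind W_wf): c0 => c IH Ac.
have [[b bc Ab]|H] := pselect (exists2 b, (b < c)%O & A b); first exact: IH Ab.
by exists c => // b bc Ab; apply: H; exists b.
Qed.

Lemma W_le_countable a : countable [set x : W | (x <= a)%O].
Proof.
apply: (@sub_countable _ _ _ ([set x : W | (x < a)%O] `|` [set a])).
  apply: subset_card_le => x /=; rewrite le_eqVlt => /orP[/eqP|];
    by [right|left].
by apply: countable_setU; [exact: W_seg|exact: countable1].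
Qed.

Lemma W_bound (A : set W) : countable A -> exists w, forall a, A a -> (a < w)%O.
Proof.
move=> cA; apply: contrapT => no; case: hW => _ + _; apply.
apply: (@sub_countable _ _ _ (\bigcup_(a in A) [set x : W | (x <= a)%O])).
  apply: subset_card_le => w _; apply: contrapT => H.
  apply: no; exists w => a Aa; rewrite ltNge; apply/negP => wa.
  by apply: H; exists a.
by apply: bigcup_countable => // a _; exact: W_le_countable.
Qed.

Lemma W_bound_range (u : nat -> W) : exists w, forall n, (u n < w)%O.
Proof.
have [w H] := W_bound (countable_range u).
by exists w => n; apply: H; exists n.
Qed.

(** The cardinal inequality [aleph_1 * aleph_0 <= aleph_1]: row [a] is a strictly increasing sequence that starts above all earlier rows. *)
Lemma W_pairing :
  exists g : W -> nat -> W, forall a m b n, g a m = g b n -> a = b /\ m = n.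
Proof.
pose Phi a (f : W -> nat -> W) (v : nat -> W) := injective v /\
  forall b, (b < a)%O -> forall m n, v m <> f b n.
have [w0 _] : exists w : W, True.
  by have [w _] := W_bound (@countable0 W); exists w.
have /choice[s sgt] : forall a, exists c, (a < c)%O.
  by move=> a; have [w] := W_bound (countable1 a); exists w; exact: p.
have [||g Pg] := @wf_choice _ _ _ Phi (fun _ => w0) W_wf.
- move=> a f f' v ff' [vi H]; split=> // b ba m n.
  by rewrite -ff' //; exact: H.
- move=> a f _.
  have [|w wP] := @W_bound (\bigcup_(b in [set b : W | (b < a)%O]) range (f b)).
    apply: bigcup_countable; first exact: W_seg.
    by move=> b _; exact: countable_range.
  have incr m n : (m < n)%N -> (iter m s w < iter n s w)%O.
    elim: n => // n IH; rewrite ltnS leq_eqVlt => /orP[/eqP->|/IH H] /=.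
      exact: sgt.
    exact: lt_trans (sgt _).
  have wle n : (w <= iter n s w)%O.
    by case: n => // n; apply: ltW; exact: (incr 0%N).
  exists (fun n => iter n s w); split.
    move=> m n; case: (ltngtP m n) => // /incr + e.
      by rewrite e ltxx.
    by rewrite e ltxx.
  move=> b ba m n e; have := wP (f b n); rewrite -e ltNge wle => /(_ _)/negP.
  by apply=> //; rewrite e; exists b => //; exists n.
exists g => a m b n e; case: (ltgtP a b) => ab.
- by have [_ /(_ a ab n m)] := Pg b; rewrite e.
- by have [_ /(_ b ab m n)] := Pg a; rewrite e.
- by split=> //; have [+ _] := Pg b; apply; rewrite -e ab.
Qed.

Definition limit a :=
  (exists b, (b < a)%O) /\
  forall b, (b < a)%O -> exists2 c, (b < c)%O & (c < a)%O.

(** Closure points are cofinal because the supremum of an increasing sequence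
    [a, s a, s (s a), ...] is one as soon as [s w] exceeds all values of [f] on
    the segment up to [w]; segments are countable, so such an [s] exists. *)
Lemma club_closure (f : W -> W) :
  club [set a | limit a /\ forall b, (b < a)%O -> (f b < a)%O].
Proof.
split=> [a|a [b0 b0a] H]; last first.
  split=> [|b /H[c [_ fc] /andP[bc ca]]]; last exact: lt_trans (fc _ bc) ca.
  by split=> [|b /H[c _ /andP[]]]; [exists b0|exists c].
have /choice[s sP] : forall w, exists w', (w < w')%O /\
    forall x, (x <= w)%O -> (f x < w')%O.
  move=> w; have [|w' w'P] := @W_bound (w |` (f @` [set x : W | (x <= w)%O])).
    apply: countable_setU; first exact: countable1.
    exact/countable_image/W_le_countable.
  exists w'; split; first by apply: w'P; left.
  by move=> x xw; apply: w'P; right; exists x.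
have [|c cP cmin] := @W_least [set w | forall n, (iter n s a < w)%O].
  by have [w wP] := W_bound_range (fun n => iter n s a); exists w.
have below b : (b < c)%O -> exists n, (b <= iter n s a)%O.
  move=> /cmin H; apply: contrapT => no; apply: H => n /=.
  by rewrite ltNge; apply/negP => le; apply: no; exists n.
exists c; last exact: (cP 0%N).
split=> [|b /below[n bn]]; last first.
  by apply: lt_trans (cP n.+1); apply: (sP _).2.
split=> [|b /below[n bn]]; first by exists a; exact: (cP 0%N).
by exists (iter n.+1 s a) => //; apply: le_lt_trans bn (sP _).1.
Qed.

(** Diamond guesses subsets of [E] along a continuous filtration of [E] by
    countable sets: code [E] into [W] injectively and restrict to the club of
    those [a] for which the codes of elements of [F a] lie below [a]. Closure
    under one more function [f] comes for free and is what makes facts about a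
    set reflect to its guessed part. *)
Lemma diamond_transfer (E : Type) (F : W -> set E) :
  diamond W -> (forall a, countable (F a)) -> (forall x, exists a, F a x) ->
  (forall a, limit a -> forall x, F a x -> exists2 b, (b < a)%O & F b x) ->
  exists S : W -> set E, forall (X : set E) (f : W -> W), exists a,
    [/\ limit a, forall b, (b < a)%O -> (f b < a)%O &
        forall x, F a x -> (S a x <-> X x)].
Proof.
move=> [S0 [_ guess]] cF /choice[r rP] lF.
have /choice[j jP] := fun a => countable_inj (cF a).
have [g gP] := W_pairing.
pose e x := g (r x) (j (r x) x).
have einj x y : e x = e y -> x = y.
  by move=> /gP[rxy]; rewrite rxy; apply: jP => //; rewrite -rxy.
have /choice[h hP] : forall a, exists w, forall x, F a x -> (e x < w)%O.
  move=> a; have [|w wP] := @W_bound (e @` F a).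
    exact: countable_image.
  by exists w => x Fx; apply: wP; exists x.
exists (fun a x => S0 a (e x)) => X f.
have [a [/= ga [la ca]]] :=
  guess (e @` X) _ (club_closure (fun b => Order.max (f b) (h b))).
exists a; split=> // [b /ca|x Fx]; first by rewrite gt_max => /andP[].
have ex : (e x < a)%O.
  have [b /ca + Fbx] := lF a la x Fx; rewrite gt_max => /andP[_].
  exact/lt_trans/hP.
rewrite -ga; split=> [[[y Xy /einj <-]] //|Xx].
by split=> //; exists x.
Qed.

(** One type of codes for both kinds of objects to be guessed: a node [(b, m)]
    of the tree is coded by [([:: b], m)], and a function [F : seq W -> bool] by
    the pairs [(s, 0)] with [F s]. *)
Definition support_below a : set (seq W * nat) :=
  [set x | forall c, c \in x.1 -> (c < a)%O].

Lemma countable_support_below a : countable (support_below a).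
Proof.
have [j jP] := countable_inj (W_seg a).
apply: (@inj_countable _ _ _ (fun x => (map j x.1, x.2))).
move=> [s m] [t n]; rewrite /support_below /= => sa ta [st ->]; congr (_, _).
elim: s t st sa ta => [|x s IH] [|y t] //= [jxy st] sa ta.
congr (_ :: _).
  by apply: jP jxy; [apply: sa|apply: ta]; rewrite mem_head.
by apply: IH => // c cs; [apply: sa|apply: ta]; rewrite inE cs orbT.
Qed.

Lemma limit_seq_below (s : seq W) a : limit a ->
  (forall c, c \in s -> (c < a)%O) ->
  exists2 b, (b < a)%O & forall c, c \in s -> (c < b)%O.
Proof.
move=> [[b0 b0a] lim]; elim: s => [|x s IH] sa; first by exists b0.
have [|b ba bP] := IH; first by move=> c cs; apply: sa; rewrite inE cs orbT.
have [|c cb ca] := lim (Order.max x b); first by rewrite gt_max ba sa ?mem_head.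
exists c => // y; rewrite inE => /orP[/eqP->|/bP yb].
  by move: cb; rewrite gt_max => /andP[].
by apply: lt_trans yb _; move: cb; rewrite gt_max => /andP[].
Qed.

(** The form of diamond from which the tree is built. *)
Lemma diamond_seq : diamond W ->
  exists S : W -> set (seq W * nat), forall X (f : W -> W), exists a,
    [/\ limit a, forall b, (b < a)%O -> (f b < a)%O &
        forall x, support_below a x -> (S a x <-> X x)].
Proof.
move=> dW; apply: diamond_transfer dW _ _ _.
- exact: countable_support_below.
- move=> [s n]; have [|a aP] := @W_bound [set` s].
    exact/finite_set_countable/finite_seq.
  by exists a.
- move=> a la [s n] /(limit_seq_below la)[b ba bP].
  by exists b.
Qed.

End Omega1.

(** * Construction of the tree *)

Section Tree.
Variables (d : Order.disp_t) (W : orderType d).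
Hypothesis hW : is_omega1 W.
Implicit Types a b c : W.

Definition ladder a (L : nat -> W) :=
  [/\ forall j, (L j < a)%O, {homo L : i j / (i < j)%N >-> (i < j)%O}
    & forall b, (b < a)%O -> exists j, (b < L j)%O].

Lemma ladder_exists a : limit a -> exists L, ladder a L.
Proof.
move=> [[b0 b0a] la].
have [j jP] := countable_inj (W_seg hW a).
(* [c] inverts [j], hence enumerates the segment below [a] *)
have /choice[c cP] : forall n, exists c, (c < a)%O /\
    forall b, (b < a)%O -> j b = n -> b = c.
  move=> n; have [[b [ba bn]]|H] := pselect (exists b, (b < a)%O /\ j b = n).
    by exists b; split=> // b' b'a b'n; apply: jP => //; rewrite bn.
  by exists b0; split=> // b ba bn; case: H; exists b.
have /choice[s sP] : forall bn, exists b', (bn.1 < a)%O ->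
    [/\ (bn.1 < b')%O, (c bn.2 < b')%O & (b' < a)%O].
  move=> [b n] /=; have [ba|nba] := boolP (b < a)%O; last by exists b.
  have [|b'] := la (Order.max b (c n)).
    by rewrite gt_max ba (cP n).1.
  by rewrite gt_max => /andP[] bb' cb' b'a; exists b'.
pose L := fix L n := if n is n'.+1 then s (L n', n') else b0.
have La n : (L n < a)%O by elim: n => // n IH; case: (sP (L n, n) IH).
exists L; split=> // [|b ba].
  apply: homo_ltn => [x y z|n]; first exact: lt_trans.
  by case: (sP (L n, n) (La n)).
exists (j b).+1; have [_ + _] := sP (L (j b), j b) (La _).
by rewrite -((cP (j b)).2 b ba erefl).
Qed.

Variables (S : W -> set (seq W * nat)) (L : W -> nat -> W).
Hypothesis hL : forall a, limit a -> ladder a (L a).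

(** Reply of Black, according to the strategy guessed at [a], when White plays
    along the ladder of [a]. *)
Definition answer a j : bool := `[< S a (mkseq (L a) j.+1, 0%N) >].

Definition dense_guess a (h : W -> nat -> W -> nat) :=
  forall b m, (b < a)%O -> exists c k,
    [/\ (b <= c)%O, (c < a)%O, h c k b = m & S a ([:: c], k)].

(** The nodes of level [a] are the pairs [(a, n)], and [v n b] is the index of
    the ancestor of [(a, n)] on level [b]; [h] gives the levels already built.
    The third clause makes the tree branch: every node has even and odd
    extensions on every higher level. The fourth clause puts level [a] above the
    dense set guessed at [a]. In the last one White's [j]-th move is the set of
    even nodes on level [L a j]; Black's answer [true] selects the complement of
    it, and the clause says that every node of level [a] eventually avoids the
    side that Black has selected. *)
Definition level_spec a (h : W -> nat -> W -> nat) (v : nat -> W -> nat) :=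
  [/\ forall n, v n a = n,
      forall n b c, (b <= c)%O -> (c < a)%O -> h c (v n c) b = v n b,
      forall b m e, (b < a)%O -> exists2 n, v n b = m & odd n = e,
      limit a -> dense_guess a h ->
        forall n, exists2 b, (b < a)%O & S a ([:: b], v n b)
    & limit a -> forall n, exists k, forall j, (k <= j)%N ->
        odd (v n (L a j)) = ~~ answer a j].

Section Branch.
Variables (a : W) (h : W -> nat -> W -> nat).
Hypothesis spec : forall b, (b < a)%O -> level_spec b h (h b).

Let h_id c n : (c < a)%O -> h c n c = n.
Proof. by move=> /spec[]. Qed.

Let h_coh b c c' n : (b <= c)%O -> (c <= c')%O -> (c' < a)%O ->
  h c (h c' n c) b = h c' n b.
Proof.
move=> bc; rewrite le_eqVlt => /orP[/eqP<- ca|cc' c'a].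
  by rewrite h_id.
by case: (spec c'a) => _ + _ _ _; apply.
Qed.

(** The play along the ladder is fixed before any branch is chosen, since it
    depends on the guess alone. So each branch can be built separately: enter
    the guessed dense set if it is dense, then climb the ladder and take at each
    rung an extension of the parity opposite to Black's answer. Finitely many
    rungs below the starting node are out of control, whence the bound [k]. *)
Lemma branch_exists b m : limit a -> (b < a)%O ->
  exists v : W -> nat,
    [/\ v b = m,
        forall c c', (c <= c')%O -> (c' < a)%O -> h c' (v c') c = v c,
        dense_guess a h -> exists2 c, (c < a)%O & S a ([:: c], v c)
      & exists k, forall j, (k <= j)%N -> odd (v (L a j)) = ~~ answer a j].
Proof.
move=> la ba; have [La Lmono Lcof] := hL la.
have [b0 [m0 [bb0 b0a m0b Db0]]] : exists b0 m0, [/\ (b <= b0)%O, (b0 < a)%O,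
    h b0 m0 b = m & dense_guess a h -> S a ([:: b0], m0)].
  have [D|nD] := pselect (dense_guess a h).
    by have [c [k [? ? ? ?]]] := D b m ba; exists c, k.
  by exists b, m; split=> //; exact: h_id.
have /choice[up upP] : forall x : (W * nat) * (W * bool), exists n,
    (x.1.1 < x.2.1)%O -> (x.2.1 < a)%O ->
    h x.2.1 n x.1.1 = x.1.2 /\ odd n = x.2.2.
  move=> [[c k] [c' e]] /=.
  have [c'a|] := boolP (c' < a)%O; last by exists 0%N.
  have [cc'|] := boolP (c < c')%O; last by exists 0%N.
  by have [_ _ /(_ c k e cc')[n]] := spec c'a; exists n.
have [k b0k] := Lcof b0 b0a.
pose l i := L a (k + i)%N.
pose e i := ~~ answer a (k + i).
pose M := fix M i := if i is i'.+1 then up ((l i', M i'), (l i, e i))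
                     else up ((b0, m0), (l 0%N, e 0%N)).
have b0l : (b0 < l 0%N)%O by rewrite /l addn0.
have lS i : (l i < l i.+1)%O by apply: Lmono; rewrite addnS.
have llt i : (l i < a)%O by exact: La.
have lle i j : (i <= j)%N -> (l i <= l j)%O.
  rewrite leq_eqVlt => /orP[/eqP->//|ij].
  by apply/ltW/Lmono; rewrite ltn_add2l.
have Modd i : odd (M i) = e i.
  case: i => [|i].
    exact: (upP ((b0, m0), (l 0%N, e 0%N)) b0l (llt _)).2.
  exact: (upP ((l i, M i), (l i.+1, e i.+1)) (lS i) (llt _)).2.
have M0 : h (l 0%N) (M 0%N) b0 = m0.
  exact: (upP ((b0, m0), (l 0%N, e 0%N)) b0l (llt _)).1.
have MS i : h (l i.+1) (M i.+1) (l i) = M i.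
  exact: (upP ((l i, M i), (l i.+1, e i.+1)) (lS i) (llt _)).1.
have Mcoh i j c : (i <= j)%N -> (c <= l i)%O ->
    h (l j) (M j) c = h (l i) (M i) c.
  elim: j => [|j IH]; first by rewrite leqn0 => /eqP->.
  rewrite leq_eqVlt => /orP[/eqP<-//|]; rewrite ltnS => ij ci.
  rewrite -IH // -(h_coh (c := l j)) ?MS //.
    exact: le_trans ci (lle _ _ ij).
  exact: lle.
have /choice[J JP] : forall c, exists i, (c < a)%O -> (c <= l i)%O.
  move=> c; have [ca|] := boolP (c < a)%O; last by exists 0%N.
  have [j cj] := Lcof c ca; exists j => _.
  apply: (le_trans (ltW cj)); rewrite /l.
  have [->|k0] := posnP k; first by [].
  by apply/ltW/Lmono; rewrite -[ltnLHS]add0n ltn_add2r.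
(* the choice of the rung [J c] above [c] is immaterial, see [vE] *)
pose v c := h (l (J c)) (M (J c)) c.
have vE i c : (c <= l i)%O -> v c = h (l i) (M i) c.
  move=> ci; have ca : (c < a)%O by exact: le_lt_trans ci (llt i).
  have [Ji|iJ] := leqP (J c) i; first by rewrite /v (Mcoh _ _ _ Ji) ?JP.
  by rewrite /v (Mcoh _ _ _ (ltnW iJ)).
have vb0 : v b0 = m0 by rewrite (vE 0%N) ?M0 // ltW.
exists v; split.
- rewrite (vE 0%N) ?(le_trans bb0 (ltW b0l)) //.
  by rewrite -(h_coh _ bb0 (ltW b0l)) // M0.
- move=> c c' cc' c'a; have c'l := JP c' c'a.
  by rewrite (vE _ _ c'l) (vE (J c')) ?(le_trans cc' c'l) // h_coh.
- by move=> /Db0 Sb0; exists b0 => //; rewrite vb0.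
- exists k => j kj; rewrite -(subnKC kj) -/(l _) (vE (j - k)%N) //.
  by rewrite h_id // Modd.
Qed.

(** Countably many branches, one through each earlier node, and every branch
    gets infinitely many nodes of level [a] on top of it, of both parities. The
    tree is therefore not Hausdorff, but successor and limit levels are built
    alike. *)
Lemma level_exists : exists v, level_spec a h v.
Proof.
have [[b0 b0a]|no] := pselect (exists b, (b < a)%O); last first.
  exists (fun n _ => n); split=> //.
  - by move=> n b c _ ca; case: no; exists c.
  - by move=> b m e ba; case: no; exists b.
  - by move=> [].
  - by move=> [].
have br b m : (b < a)%O -> exists v : W -> nat,
    [/\ v b = m,
        forall c c', (c <= c')%O -> (c' < a)%O -> h c' (v c') c = v c,
        limit a -> dense_guess a h -> exists2 c, (c < a)%O & S a ([:: c], v c)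
      & limit a -> exists k, forall j, (k <= j)%N ->
          odd (v (L a j)) = ~~ answer a j].
  move=> ba; have [la|nla] := pselect (limit a).
    by have [v [? ? ? ?]] := branch_exists m la ba; exists v.
  (* below a successor the branches are those through its predecessor [t] *)
  have [t ta tmax] : exists2 t, (t < a)%O & forall c, (c < a)%O -> (c <= t)%O.
    apply: contrapT => nt; apply: nla; split; first by exists b.
    move=> c ca; apply: contrapT => nc; apply: nt; exists c => // c' c'a.
    by rewrite leNgt; apply/negP => cc'; apply: nc; exists c'.
  have [k kb] : exists k, h t k b = m.
    have := tmax b ba; rewrite le_eqVlt => /orP[/eqP->|bt].
      by exists m; rewrite h_id.
    by have [_ _ /(_ b m true bt)[k]] := spec ta; exists k.
  exists (h t k); split=> // c c' cc' c'a.
  by rewrite h_coh // tmax.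
have /choice[B BP] : forall x : W * nat, exists v : W -> nat, (x.1 < a)%O ->
    [/\ v x.1 = x.2,
        forall c c', (c <= c')%O -> (c' < a)%O -> h c' (v c') c = v c,
        limit a -> dense_guess a h -> exists2 c, (c < a)%O & S a ([:: c], v c)
      & limit a -> exists k, forall j, (k <= j)%N ->
          odd (v (L a j)) = ~~ answer a j].
  move=> [b m] /=; have [ba|] := boolP (b < a)%O; last by exists (fun=> 0%N).
  by have [v] := br b m ba; exists v.
have [j jP] := countable_inj (W_seg hW a).
have /choice[c cP] : forall n, exists x : W * nat, (x.1 < a)%O /\
    forall b m, (b < a)%O -> n = pickle (j b, m) -> x = (b, m).
  move=> n; have [[b [m [ba ->]]]|H] :=
    pselect (exists b (m : nat), (b < a)%O /\ n = pickle (j b, m)).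
    exists (b, m); split=> // b' m' b'a /(pcan_inj pickleK)[jb ->].
    by congr (_, _); exact: jP.
  by exists (b0, 0%N); split=> // b m ba bn; case: H; exists b, m.
(* the branch depends on [n./2] only, which leaves the parity of [n] free *)
pose v n b := if b == a then n else B (c n./2) b.
have vE n b : (b < a)%O -> v n b = B (c n./2) b.
  by move=> ba; rewrite /v lt_eqF.
exists v; split.
- by move=> n; rewrite /v eqxx.
- move=> n b b' bb' b'a; rewrite !vE ?(le_lt_trans bb' b'a) //.
  by case: (BP (c n./2) (cP _).1) => _ + _ _; apply.
- move=> b m e ba; exists (e + (pickle (j b, m)).*2)%N.
    rewrite vE // half_bit_double ((cP _).2 b m ba erefl).
    by case: (BP (b, m) ba).
  by rewrite oddD odd_double addbF oddb.
- move=> la D n; case: (BP (c n./2) (cP _).1) => _ _ /(_ la D)[b ba Sb] _.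
  by exists b => //; rewrite vE.
- move=> la n; case: (BP (c n./2) (cP _).1) => _ _ _ /(_ la)[k kP].
  exists k => i ki; rewrite vE ?kP //.
  by have [La _ _] := hL la; exact: La.
Qed.

End Branch.

Lemma tree_exists : exists h, forall a, level_spec a h (h a).
Proof.
apply: (wf_choice (V := nat -> W -> nat) (R := fun x y => (x < y)%O)).
- exact: (fun _ _ => 0%N).
- exact: W_wf.
- move=> a f g v fg [vid coh ext sealing par]; split=> //.
  + by move=> n b c bc ca; rewrite -fg //; exact: coh.
  + move=> la Dg; apply: sealing => // b m ba.
    by have [c [k [bc ca gc Sc]]] := Dg b m ba; exists c, k; rewrite fg.
- by move=> a f H; exact: level_exists.
Qed.

End Tree.

(** * The algebra of the tree *)

Section TreeAlgebra.
Variables (d : Order.disp_t) (W : orderType d).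
Hypothesis hW : is_omega1 W.
Variable h : W -> nat -> W -> nat.
Implicit Types a b c : W.

Definition extends (x y : W * nat) := (y.1 <= x.1)%O /\ h x.1 x.2 y.1 = y.2.

(** What the rest of the proof uses of the tree. The field [tree_seal] makes it
    a Suslin tree. In [tree_game], [F] is a strategy for Black against moves of
    the form: all even nodes on level [b]. *)
Record game_tree : Prop := GameTree {
  tree_refl : forall x, extends x x;
  tree_trans : forall y x z, extends x y -> extends y z -> extends x z;
  tree_split : forall b a m e, (b < a)%O -> exists2 n, h a n b = m & odd n = e;
  tree_seal : forall D : set (W * nat),
    (forall x y, extends y x -> D x -> D y) ->
    (forall x, exists2 y, extends y x & D y) ->
    exists a, forall b n, (a <= b)%O -> D (b, n);
  tree_game : forall F : seq W -> bool, exists a (l : nat -> W),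
    (forall j, (l j < a)%O) /\
    forall n, exists k, forall j, (k <= j)%N ->
      odd (h a n (l j)) = ~~ F (mkseq l j.+1) }.

Hypothesis hT : game_tree.

Definition tree := Preorder (tree_refl hT) (tree_trans hT).

Local Notation node a n := ((a, n) : tree).

Implicit Types (x y z : tree) (D : set tree).

Lemma extends_above x a : exists2 y, ple y x & (a <= y.1)%O.
Proof.
have [ax|xa] := leP a x.1; first by exists x => //; exact: ple_refl.
have [n nx _] := tree_split hT x.2 true xa.
by exists (node a n) => //; split=> //; exact: ltW.
Qed.

Lemma extends_ancestor x a : (a <= x.1)%O -> ple x (node a (h x.1 x.2 a)).
Proof. by []. Qed.

Lemma ancestor_ple x y a : ple y x -> (a <= x.1)%O ->
  h y.1 y.2 a = h x.1 x.2 a.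
Proof.
by move=> yx ax; have [] := ple_trans yx (extends_ancestor ax).
Qed.

Lemma ancestor_self a n : h a n a = n.
Proof. by have [] := tree_refl hT (a, n). Qed.

(** The intersection of countably many dense open sets is dense open; this is
    where distributivity of the algebra comes from. *)
Lemma dense_common_level (I : countType) (D : I -> set tree) :
  (forall i, down_closed (D i)) ->
  (forall i x, exists2 y, ple y x & D i y) ->
  exists a, forall i x, (a <= x.1)%O -> D i x.
Proof.
move=> dD eD.
have /choice[l lP] : forall i, exists a, forall b n, (a <= b)%O -> D i (b, n).
  by move=> i; apply: (tree_seal hT) => [x y|x]; [exact: dD|exact: eD].
have [w wP] := W_bound hW (countable_range l).
exists w => i [b n] /= wb; apply: lP; apply: le_trans wb; apply/ltW/wP.
by exists i.
Qed.

Definition decided (U : set tree) : set tree :=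
  [set x | U x \/ forall y, ple y x -> ~ U y].

Lemma decided_down U : down_closed U -> down_closed (decided U).
Proof.
move=> dU x y yx [Ux|nU]; first by left; exact: dU Ux.
by right=> z zy; apply: nU; exact: ple_trans yx.
Qed.

Lemma decided_dense U x : exists2 y, ple y x & decided U y.
Proof.
have [[y yx Uy]|nU] := pselect (exists2 y, ple y x & U y).
  by exists y => //; left.
exists x; first exact: ple_refl.
by right=> y yx Uy; apply: nU; exists y.
Qed.

Lemma decided_common_level (I : countType) (U : I -> set tree) :
  (forall i, down_closed (U i)) ->
  exists a, forall i x, (a <= x.1)%O -> decided (U i) x.
Proof.
move=> dU; apply: dense_common_level => [i|i x]; last exact: decided_dense.
exact: decided_down.
Qed.

Let B := ro tree.

Lemma tree_nontrivial : (\bot%O : B) <> \top%O.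
Proof.
move=> e; have [w _] := W_bound hW (@countable0 W).
have : ro_set (\top%O : B) (node w 0%N) by [].
by rewrite -e.
Qed.

Lemma W_above a : exists b, (a < b)%O.
Proof. by have [b bP] := W_bound hW (countable1 a); exists b; exact: bP. Qed.

Lemma tree_atomless : atomless B.
Proof.
move=> b /ro_gt0P[x bx]; have [a xa] := W_above x.1.
have [n nx nev] := tree_split hT x.2 false xa.
have [n' nx' nodd] := tree_split hT x.2 true xa.
have le0 k : h a k x.1 = x.2 -> ple (node a k) x by split=> //; exact: ltW.
pose c : B := ro_cl [set z : tree | ple z (node a n)].
have cn : ro_set c (node a n).
  by apply: sub_cl; [move=> y z zy yn; exact: ple_trans yn|exact: ple_refl].
exists (Order.meet b c); apply/andP; split.
  apply/ro_gt0P; exists (node a n); split=> //.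
  exact: ro_down (le0 _ nx) bx.
rewrite lt_neqAle leIl andbT; apply/eqP => e.
have : ro_set b (node a n') by apply: ro_down (le0 _ nx') bx.
rewrite -e => -[_ /(_ _ (ple_refl _))[z zn' zn]].
have := ancestor_ple zn' (lexx _); rewrite (ancestor_ple zn (lexx _)) /=.
by rewrite !ancestor_self => nn'; rewrite -nn' nev in nodd.
Qed.

(** On some level every node decides whether it meets the join of the antichain,
    and if so lies in a member, which is unique; so the members inject into that
    countable level. *)
Lemma tree_ccc : ccc B.
Proof.
move=> A [A0 Adisj].
pose U : set tree := [set x | exists2 u : B, A u & ro_set u x].
have dU : down_closed U.
  by move=> x y yx [u Au ux]; exists u => //; exact: ro_down ux.
have [a aP] := @decided_common_level unit (fun=> U) (fun=> dU).
have disj (u v : B) x : A u -> A v -> ro_set u x -> ro_set v x -> u = v.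
  move=> Au Av ux vx; apply: contrapT => uv.
  have : ro_set (Order.meet u v) x by [].
  by rewrite Adisj.
have /choice[f fP] : forall u : B, exists n, A u -> ro_set u (node a n).
  move=> u; have [Au|] := pselect (A u); last by exists 0%N.
  have /ro_gt0P[x ux] := A0 u Au; have [y yx ay] := extends_above x a.
  have uy := ro_down yx ux; exists (h y.1 y.2 a) => _.
  have yz := extends_ancestor ay.
  have [[v Av vz]|] := aP tt (node a (h y.1 y.2 a)) (lexx _).
    by rewrite (disj u v y) //; exact: ro_down yz vz.
  by move=> /(_ y yz); case; exists u.
apply: (@inj_countable _ _ _ f) => u v Au Av fuv.
have := fP v Av; rewrite -fuv; exact: disj (fP u Au).
Qed.

Lemma tree_omega_distributive : omega_distributive B.
Proof.
move=> I u; apply: le_anti; apply/andP; split; last first.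
  apply: bjoin_le => [|_ [f _ <-]]; first exact: ro_complete.
  apply: bmeet_ge => [|_ [n _ <-]]; first exact: ro_complete.
  apply: (@le_trans _ _ (u n (f n))).
    by apply: bmeet_lb; [exact: ro_complete|exists n].
  by apply: bjoin_ub; [exact: ro_complete|exists (f n)].
pose U n : set tree := [set x | exists i, ro_set (u n i) x].
have dU n : down_closed (U n).
  by move=> x y yx [i ux]; exists i; exact: ro_down ux.
have [a aP] := decided_common_level dU.
apply/ro_leP => x /ro_bmeetP ux; apply/ro_bjoinP => y yx.
have [z zy az] := extends_above y a; exists z => //.
have /choice[f fP] : forall n, exists i, ro_set (u n i) z.
  move=> n; have [//|nU] := aP n z az.
  have /ro_bjoinP /(_ z (ple_trans zy yx)) [t tz [_ [i _ <-] it]] :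
    ro_set (bjoin (range (u n))) x by apply: ux; exists n.
  by case: (nU t tz); exists i.
exists (bmeet (range (fun n => u n (f n)))); first by exists f.
by apply/ro_bmeetP => _ [n _ <-].
Qed.

(** The strategy of White uses countably many moves in total, one for each
    finite sequence of answers. A node [z] below [p] on a high level decides all
    of them, and Black survives by always answering with the side that contains
    [z]. *)
Lemma white_loses_G1 : ~ exists p sigma, white_wins (@G1 _ B) p sigma.
Proof.
move=> [p [sigma [/ro_gt0P[x px] win]]].
pose hist (s : seq bool) : seq (B * bool) :=
  foldl (fun t e => rcons t (sigma t, e)) [::] s.
have [a aP] := @decided_common_level _ (fun s => ro_set (sigma (hist s)))
  (fun s => @ro_down _ _).
have [z zx az] := extends_above x a.
pose bit s := `[< ~ ro_set (sigma (hist s)) z >].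
pose pre := fix pre n := if n is n'.+1 then rcons (pre n') (bit (pre n'))
                         else [::].
pose q n := sigma (hist (pre n)); pose i n := bit (pre n).
have histE n : history q i n = hist (pre n).
  elim: n => // n IH; rewrite /history mkseqS -/(history q i n) IH /=.
  by rewrite /hist foldl_rcons.
have [_] := win q i (fun n => congr1 sigma (esym (histE n))).
move=> /ro_eq0P /(_ z); apply; apply/ro_bmeetP => _ [n _ <-].
rewrite /i /bit; have pz := ro_down zx px.
case: asboolP => /= [nq|/contrapT //].
apply/ro_diffP; split=> // y yz.
by have [/nq|] := aP (pre n) z az; last exact.
Qed.

Definition evens b : B :=
  ro_cl [set x : tree | (b <= x.1)%O /\ ~~ odd (h x.1 x.2 b)].

(** Membership is decided by the ancestor on level [b], at any node above it. *)
Lemma evensP b x : (b <= x.1)%O -> ro_set (evens b) x <-> ~~ odd (h x.1 x.2 b).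
Proof.
move=> bx; split=> [/(_ x (ple_refl x))[y yx [_]]|ev].
  by rewrite (ancestor_ple yx).
apply: sub_cl => // {bx ev} x y yx [bx ev]; split.
  by apply: le_trans bx _; case: yx.
by rewrite (ancestor_ple yx).
Qed.

Lemma evens_legal b : legal \top%O (evens b).
Proof.
have [w _] := W_bound hW (@countable0 W).
apply/andP; split.
  apply/ro_gt0P; exists (node b 0%N); apply/evensP => //=.
  by rewrite ancestor_self.
rewrite lt_neqAle lex1 andbT; apply/eqP => e.
have : ro_set (evens b) (node b 1%N) by rewrite e.
by move=> /evensP /= /(_ (lexx _)); rewrite ancestor_self.
Qed.

(** White plays [evens] along the ladder supplied by [tree_game]. Every node on
    a level above [a] then lies outside the side selected by Black in all but
    finitely many moves, and those nodes are dense, so the limit superior of the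
    selected sides vanishes. *)
Lemma black_loses_G4 : ~ exists tau, black_wins (@G4 _ B) tau.
Proof.
move=> [tau win].
pose hist (s : seq W) : seq (B * bool) :=
  foldl (fun t b => rcons t (evens b, tau \top%O t (evens b))) [::] s.
pose F s := (last (\bot%O, false) (hist s)).2.
have [a [l [la lP]]] := tree_game hT F.
pose q n := evens (l n); pose i n := F (mkseq l n.+1).
have histS n : hist (mkseq l n.+1) = rcons (hist (mkseq l n))
    (evens (l n), tau \top%O (hist (mkseq l n)) (evens (l n))).
  by rewrite mkseqS /hist foldl_rcons.
have iE n : i n = tau \top%O (hist (mkseq l n)) (evens (l n)).
  by rewrite /i /F histS last_rcons.
have histE n : history q i n = hist (mkseq l n).
  by elim: n => // n IH; rewrite /history mkseqS -/(history q i n) IH iE histS.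
have top0 : (\bot < (\top : B))%O.
  by rewrite lt0x; apply/eqP => e; apply: tree_nontrivial.
apply: (win \top%O q i) => // [n|n|]; first exact: evens_legal.
  by rewrite histE iE.
apply/ro_eq0P => x /ro_bmeetP xlim.
have [y yx ay] := extends_above x a.
have [k kP] := lP (h y.1 y.2 a).
have /ro_bjoinP /(_ y yx)[z zy [_ [j /= kj <-]]] :
  ro_set (bjoin [set side \top%O (q n) (i n) | n in [set n | (k <= n)%N]]) x.
  by apply: xlim; exists k.
have lja := ltW (la j).
have lz : (l j <= z.1)%O.
  by apply: (le_trans lja); apply: (le_trans ay); case: zy.
have par : odd (h z.1 z.2 (l j)) = ~~ i j.
  rewrite /i -(kP _ kj) (ancestor_ple zy) ?(le_trans lja) //.
  by rewrite (ancestor_ple (extends_ancestor ay)).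
case: (i j) par => par; rewrite /side.
  move=> /ro_diffP[_ /(_ z (ple_refl z))]; apply; apply/evensP => //.
  by rewrite par.
by move=> /evensP -/(_ lz); rewrite par.
Qed.

End TreeAlgebra.

(** * Comparison of the games *)

Section Games.
Variables (d : Order.disp_t) (B : ctbDistrLatticeType d).
Hypothesis cB : complete B.
Implicit Types (p : B) (q : nat -> B) (i : nat -> bool).

Lemma le_bot (x y : B) : (x <= y)%O -> y = \bot%O -> x = \bot%O.
Proof. by move=> + y0; rewrite y0 lex0 => /eqP. Qed.

Lemma G2_G1 p q i : G2 p q i -> G1 p q i.
Proof.
apply: le_bot; apply: (@le_trans _ _
  (bmeet [set side p (q n) (i n) | n in [set n | (0 <= n)%N]])).
  by apply: bmeet_ge => // _ [n _ <-]; apply: bmeet_lb => //; exists n.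
by apply: bjoin_ub => //; exists 0%N.
Qed.

Lemma infinite_tail k : infinite_set [set n | (k <= n)%N].
Proof.
move=> fin; apply: infinite_nat.
apply: (@sub_finite_set _ _ (`I_k `|` [set n | (k <= n)%N])) => [n _|].
  by case: (ltnP n k) => ?; [left|right].
by rewrite finite_setU; split=> //; exact: finite_II.
Qed.

Lemma G3_G2 p q i : G3 p q i -> G2 p q i.
Proof.
apply: le_bot; apply: bjoin_le => // _ [k _ <-].
apply: bjoin_ub => //; exists [set n | (k <= n)%N] => //.
exact: infinite_tail.
Qed.

Lemma G4_G3 p q i : G4 p q i -> G3 p q i.
Proof.
apply: le_bot; apply: bjoin_le => // _ [A Ainf <-].
apply: bmeet_ge => // _ [k _ <-].
have [n An kn] : exists2 n, A n & (k <= n)%N.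
  apply: contrapT => H; apply: Ainf; apply: sub_finite_set (finite_II k).
  by move=> n An /=; rewrite ltnNge; apply/negP => kn; apply: H; exists n.
apply: (@le_trans _ _ (side p (q n) (i n))).
  by apply: bmeet_lb => //; exists n.
by apply: bjoin_ub => //; exists n.
Qed.

(** A winning strategy passes from a game that is harder for its owner to an
    easier one, so it is enough to refute White in the game most favourable to
    White and Black in the game most favourable to Black. *)
Lemma undetermined_between (G : game B) :
  (forall p q i, G4 p q i -> G p q i) -> (forall p q i, G p q i -> G1 p q i) ->
  ~ (exists p sigma, white_wins (@G1 _ B) p sigma) ->
  ~ (exists tau, black_wins (@G4 _ B) tau) -> undetermined G.
Proof.
move=> G4G GG1 nw nb; split=> [[p [sigma [p0 win]]]|[tau win]].
  apply: nw; exists p, sigma; split=> // q i qs.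
  by have [leg /GG1] := win q i qs.
by apply: nb; exists tau => p q i p0 leg ti /G4G; exact: win.
Qed.

End Games.

(** * Diamond yields the tree *)

(** Density of [D] is witnessed by a function [g] on nodes; at an [a] closed
    under the levels that [g] reaches, the part of [D] below [a] is dense below [a].
    Level [a] of the tree then lies in [D], hence so do all higher levels. *)
Lemma game_tree_exists (d : Order.disp_t) (W : orderType d) :
  is_omega1 W -> diamond W -> exists h : W -> nat -> W -> nat, game_tree h.
Proof.
move=> hW dW; have [S guess] := diamond_seq hW dW.
have /choice[L hL] : forall a : W, exists L, limit a -> ladder a L.
  move=> a; have [/(ladder_exists hW)[L]|] := pselect (limit a).
    by exists L.
  by exists (fun=> a).
have [h hP] := tree_exists hW S hL.
have h_id a n : h a n a = n by case: (hP a).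
have coh a b c n : (b <= c)%O -> (c <= a)%O -> h c (h a n c) b = h a n b.
  move=> bc; rewrite le_eqVlt => /orP[/eqP->|ca]; first by rewrite h_id.
  by case: (hP a) => _ + _ _ _; apply.
exists h; split.
- by move=> [a n]; split.
- move=> [b m] [a n] [c k] [/= ba am] [/= cb bk]; split=> /=.
    exact: le_trans ba.
  by rewrite -(coh a c b) // am.
- by move=> b a m e ba; case: (hP a) => _ _ /(_ b m e ba).
- move=> D dD eD.
  have /choice[g gP] : forall x, exists y, extends h y x /\ D y.
    by move=> x; have [y] := eD x; exists y.
  have /choice[f fP] : forall b, exists w, forall m, ((g (b, m)).1 < w)%O.
    by move=> b; apply: (W_bound_range hW (fun m => (g (b, m)).1)).
  have [a [la fa Sa]] :=
    guess [set x | exists b, x.1 = [:: b] /\ D (b, x.2)] f.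
  have SD b m : (b < a)%O -> S a ([:: b], m) <-> D (b, m).
    move=> ba; rewrite Sa; first last.
      by move=> c; rewrite inE => /eqP->.
    by split=> [[_ [[<-]]]|Dbm] //; exists b.
  have seal n : D (a, n).
    have [_ _ _ /(_ la) + _] := hP a; case/(_ _ n) => [b m ba|b ba].
      have [[bg gb] Dg] : extends h (g (b, m)) (b, m) /\ D (g (b, m)).
        by case: (gP (b, m)).
      have ga : ((g (b, m)).1 < a)%O by apply: lt_trans (fP b m) (fa b ba).
      exists (g (b, m)).1, (g (b, m)).2; split=> //.
      by apply/SD => //; rewrite -surjective_pairing.
    move=> /SD -/(_ ba); apply: dD; split=> //=; exact: ltW.
  exists a => b n ab; apply: dD (seal (h b n a)); by split.
- move=> F; have [a [la _ Sa]] := guess [set x | F x.1] id.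
  exists a, (L a); have [lta _ _] := hL a la; split=> // n.
  have [_ _ _ _ /(_ la n)[k kP]] := hP a.
  exists k => j /kP ->; congr (~~ _); apply/asboolP/idP; last first.
    by move=> Fj; apply/Sa => // c /= /mapP[x _ ->].
  by move=> /Sa /=; apply => c /= /mapP[x _ ->].
Qed.

Theorem theorem10 (dW : Order.disp_t) (W : orderType dW) :
  is_omega1 W -> diamond W ->
  exists (d : Order.disp_t) (B : ctbDistrLatticeType d),
    suslin_algebra B /\
    [/\ undetermined (@G1 d B), undetermined (@G2 d B),
        undetermined (@G3 d B) & undetermined (@G4 d B)].
Proof.
move=> hW hD; have [h hT] := game_tree_exists hW hD.
exists ro_display, (ro (tree hT)).
have cB := @ro_complete (tree hT).
have g21 := G2_G1 cB; have g32 := G3_G2 cB; have g43 := G4_G3 cB.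
have nw := white_loses_G1 hW (hT := hT).
have nb := black_loses_G4 hW (hT := hT).
split.
  split; first exact: tree_nontrivial.
  split=> //; [exact: tree_atomless|exact: tree_ccc|].
  exact: tree_omega_distributive.
by split; apply: undetermined_between nw nb => p q i; auto.
Qed.
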